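(* Let $r\geq1$ and $n\geq1$. Then $0^{n}\in\mathcal{Z}(O\Gamma_{n}^{(1,r)})$ and $rad(O\Gamma_{n}^{(1,r)})=\lceil \frac{nr}{r+1}\rceil$. Furthermore: (1) if $n\equiv 0 \pmod{r+1}$, then $\mathcal{Z}(O\Gamma_{n}^{(1,r)})=\{0^{n}\}$ and $|\mathcal{Z}(O\Gamma_{n}^{(1,r)})|=1$; (2) if $n \bmod (r+1)=k\neq0$, then $\mathcal{Z}(O\Gamma_{n}^{(1,r)})=\mathcal{Z}(O\Gamma_{n-r-1}^{(1,r)})^{\vee}$, with initial set $\mathcal{Z}(O\Gamma_{k}^{(1,r)})$ equal to the set of all binary words of length $k$, and $$|\mathcal{Z}(O\Gamma_{n}^{(1,r)})|=\sum_{j=1}^{k+1}a_{j}\Big\lceil\frac{n}{r+1}\Big\rceil^{k+1-j},$$ where $(a_1,\ldots,a_{k+1})^{T}=A^{-1}b$, $A$ is the $(k+1)\times(k+1)$ matrix whose $i$-th row is $(i^{k},i^{k-1},\ldots,i,1)$ for $i=1,\ldots,k+1$, and $b=(|\mathcal{Z}(O\Gamma_{k}^{(1,r)})|,|\mathcal{Z}(O\Gamma_{k+(r+1)}^{(1,r)})|,\ldots,|\mathcal{Z}(O\Gamma_{k+k(r+1)}^{(1,r)})|)^{T}$.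
   Context: For $r\ge1$, $n\ge1$, $O\Gamma_{n}^{(1,r)}$ is the graph whose vertices are the binary words of length $n$ containing no factor $1^{r+1}$ (no $r+1$ consecutive ones), two vertices being adjacent iff they differ in exactly one coordinate. $0^s$ and $1^s$ denote runs of $s$ zeros/ones. For a connected graph $G$, the eccentricity of $v$ is $e(v)=\max_{u}d(v,u)$, the radius is $rad(G)=\min_v e(v)$, and the center $\mathcal{Z}(G)$ is the set of vertices $v$ with $e(v)=rad(G)$. For a set $S$ of binary words of length $m$, $S^{\vee}$ denotes the set of words of length $m+r+1$ consisting of the words $0^{r+1}\eta$ for $\eta\in S$, together with, for each $\eta=g_1\ldots g_m\in S$ and each index $i$ with $g_i=1$, the word obtained from $\eta$ by inserting $0^{r+1}$ immediately after its $i$-th coordinate. *)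

(* Defs.v *)
From HB Require Import structures.
From mathcomp Require Import all_boot all_order all_fingroup all_algebra.

Set Implicit Arguments.
Unset Strict Implicit.
Unset Printing Implicit Defensive.

Import Order.TTheory GRing.Theory Num.Theory.

(* A finite graph is a finite type T of vertices with an adjacency relation e. *)
Section Graph.
Variables (T : finType) (e : rel T).

(* Least length of a walk from u to v.  If there is none the value is #|T|;
   otherwise it is smaller than #|T|, since a shortest walk repeats no vertex. *)
Definition dist (u v : T) : nat :=
  find (fun k => [exists p : k.-tuple T, path e u p && (last u p == v)])
       (iota 0 #|T|).

Definition ecc (v : T) : nat := \max_(u : T) dist v u.

(* Eccentricities never exceed #|T|, so the neutral element #|T| does not
   affect the minimum as soon as T is inhabited. *)
Definition radius : nat := \big[minn/#|T|]_(v : T) ecc v.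

Definition center : {set T} := [set v | ecc v == radius].

End Graph.

(* Letters are booleans: true is 1 and false is 0. *)
Definition run_free (r : nat) (w : seq bool) : bool :=
  ~~ infix (nseq r.+1 true) w.

Definition OGamma (r n : nat) : finType :=
  {w : n.-tuple bool | run_free r w} : finType.

Definition OGamma_adj (r n : nat) : rel (OGamma r n) :=
  fun u v => #|[set i | tnth (val u) i != tnth (val v) i]| == 1.

Definition rad_OGamma (r n : nat) : nat := radius (@OGamma_adj r n).

(* The center, regarded as a set of binary words. *)
Definition Z (r n : nat) : {set n.-tuple bool} :=
  val @: center (@OGamma_adj r n).

Definition zero_word (n : nat) : n.-tuple bool := [tuple of nseq n false].

(* The coordinate i : 'I_m is 0-based, so the prefix of h that ends with that
   coordinate is take i.+1 h. *)
Definition vee (r m : nat) (S : {set m.-tuple bool}) :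
    {set (m + r.+1).-tuple bool} :=
  [set w : (m + r.+1).-tuple bool | [exists h : m.-tuple bool in S,
     (w == nseq r.+1 false ++ h :> seq bool)
     || [exists i : 'I_m, tnth h i &&
           (w == take i.+1 h ++ nseq r.+1 false ++ drop i.+1 h :> seq bool)]]].

Local Open Scope ring_scope.

(* The 1-based row and column numbers are i.+1 and j.+1, hence the exponent
   k + 1 - j.+1 = k - j of the j-th column. *)
Definition pow_mx (k : nat) : 'M[rat]_k.+1 :=
  \matrix_(i < k.+1, j < k.+1) (i.+1%:R ^+ (k - j)%N).

Definition card_col (r k : nat) : 'cV[rat]_k.+1 :=
  \col_(i < k.+1) (#|Z r (k + i * r.+1)%N|%:R).

Definition coef_col (r k : nat) : 'cV[rat]_k.+1 :=
  invmx (pow_mx k) *m card_col r k.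

Lemma pow_mx_unit (k : nat) : pow_mx k \in unitmx.
Proof.
pose V := Vandermonde k.+1 (\row_(j < k.+1) (j.+1%:R : rat)).
have -> : pow_mx k = col_perm (perm (@rev_ord_inj k.+1)) V^T.
  by apply/matrixP => i j; rewrite !mxE permE /= subSS.
rewrite col_permE unitmx_mul unitmx_perm andbT unitmx_tr unitmxE.
rewrite det_Vandermonde unitfE.
apply/prodf_neq0 => i _; apply/prodf_neq0 => j ltij.
by rewrite !mxE subr_eq0 eqr_nat eqSS gtn_eqF.
Qed.

Lemma run_freeP (r : nat) (w : seq bool) :
  reflect (exists2 i, (i + r < size w)%N &
             forall j, (j <= r)%N -> nth false w (i + j)%N)
          (~~ run_free r w).
Proof.
rewrite /run_free negbK; apply: (iffP (@infixP _ _ _)) => [[p [s ->]]|[i lti onei]].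
  exists (size p) => [|j lejr].
    by rewrite !size_cat size_nseq ltn_add2l ltn_addr.
  by rewrite nth_cat ltnNge leq_addr addKn nth_cat size_nseq ltnS lejr
             nth_nseq ltnS lejr.
exists (take i w), (drop (i + r.+1) w); rewrite addnC -drop_drop.
suff -> : nseq r.+1 true = take r.+1 (drop i w) by rewrite !cat_take_drop.
have le_size : (r.+1 <= size (drop i w))%N.
  by rewrite size_drop ltn_subRL.
apply: (@eq_from_nth _ false) => [|j].
  by rewrite size_nseq size_takel.
rewrite size_nseq => ltj; rewrite nth_nseq ltj nth_take // nth_drop.
by rewrite onei.
Qed.

Lemma OGamma_connected (r n : nat) (u v : OGamma r n) :
  connect (@OGamma_adj r n) u v.
Proof.
have adj_sym : symmetric (@OGamma_adj r n).
  move=> x y; rewrite /OGamma_adj; congr (_ == _); apply: eq_card => i.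
  by rewrite !inE eq_sym.
have zP : run_free r (zero_word n).
  apply: contraT => /run_freeP[i _ /(_ 0%N isT)].
  by rewrite nth_nseq; case: ifP.
pose z : OGamma r n := Sub (zero_word n) zP.
suff to_zero x : connect (@OGamma_adj r n) x z.
  apply: connect_trans (to_zero u) _.
  by rewrite (sym_connect_sym adj_sym).
have [k] := ubnP #|[set i | tnth (val x) i]|.
elim: k x => // k IHk x; rewrite ltnS => lek.
have [zx|[i]] := set_0Vmem [set i | tnth (val x) i].
  suff -> : x = z by exact: connect0.
  apply/val_inj/eq_from_tnth => i /=.
  have := in_set0 i; rewrite -zx inE => ->.
  by rewrite (tnth_nth false) /= nth_nseq if_same.
rewrite inE => xi.
pose w := [tuple (j != i) && tnth (val x) j | j < n].
have wP : run_free r w.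
  apply: contraT => /run_freeP[a]; rewrite size_tuple => lta onea.
  have := valP x; apply: contraLR => _.
  apply/run_freeP; exists a; first by rewrite size_tuple.
  move=> j lejr; have := onea j lejr.
  have ltaj : (a + j < n)%N.
    by apply: leq_ltn_trans lta; rewrite leq_add2l.
  have -> : nth false w (a + j)%N = tnth w (Ordinal ltaj).
    by rewrite (tnth_nth false).
  by rewrite tnth_mktuple (tnth_nth false) => /andP[].
pose y : OGamma r n := Sub w wP.
have ywE j : tnth (val y) j = (j != i) && tnth (val x) j by rewrite tnth_mktuple.
apply: (@connect_trans _ _ y).
  apply: connect1; rewrite /OGamma_adj; apply/eqP; rewrite -(cards1 i).
  apply: eq_card => j; rewrite !inE ywE.
  by case: (eqVneq j i) => [->|_] /=; rewrite ?xi ?eqxx.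
apply: IHk; apply: leq_trans lek; apply: proper_card; apply/properP.
split; first by apply/subsetP => j; rewrite !inE ywE => /andP[].
by exists i; rewrite !inE ?ywE ?eqxx.
Qed.

(* Main.v *)
Require Import Defs.
From mathcomp Require Import all_boot all_order all_algebra zify.

Set Implicit Arguments.
Unset Strict Implicit.
Unset Printing Implicit Defensive.

Import Order.TTheory GRing.Theory Num.Theory.

(* Distances in the graph are Hamming distances, so e(v) is n minus the least
   agreement of v with a vertex.  That least agreement is the largest number of
   disjoint factors 0^(r+1) of v: a vertex must agree with v inside each such
   factor, and the complement of v corrected once per greedy factor attains the
   bound.  Hence, with q = n div (r+1), the radius is n - q and the center
   consists of the words that contain q disjoint factors 0^(r+1); such words
   have at most n mod (r+1) = k ones.  Counting letter by letter shows that
   there are sum_t C(k,t) C(q+t,t) of them, a polynomial of degree at most k in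
   q + 1, and the Vandermonde system recovers its coefficients. *)

(** * Distance and radius in a finite graph *)

Lemma dist_eq (T : finType) (e : rel T) (u v : T) (d : nat) :
    (forall p, path e u p -> last u p = v -> d <= size p) ->
    (exists p, [/\ path e u p, last u p = v & size p = d]) ->
  dist e u v = d.
Proof.
move=> mind [p [pathp lastp sizep]]; rewrite /dist.
set a := (X in find X _).
(* Shortening the path to one without repeated vertices puts [d] in the range that [find]
   searches. *)
have ltdT : d < #|T|.
  case/shortenP: pathp (lastp) => p' pathp' uniqp' _ lastp'.
  apply: leq_ltn_trans (mind _ pathp' lastp') _.
  by rewrite -[(size p').+1]/(size (u :: p')) -(card_uniqP uniqp') max_card.
have ad : a d.
  apply/existsP; have sp : size p == d by apply/eqP.
  by exists (Tuple sp); rewrite /= pathp lastp eqxx.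
have has_a : has a (iota 0 #|T|) by apply/hasP; exists d; rewrite ?mem_iota.
apply/eqP; rewrite eqn_leq; apply/andP; split.
  rewrite leqNgt; apply/negP => /(before_find 0).
  by rewrite nth_iota // ad.
have := nth_find 0 has_a; rewrite has_find size_iota in has_a.
rewrite nth_iota // add0n => /existsP[q /andP[pathq /eqP lastq]].
by have := mind _ pathq lastq; rewrite size_tuple.
Qed.

Lemma radius_eq (T : finType) (e : rel T) (v0 : T) :
  (forall v, ecc e v0 <= ecc e v) -> radius e = ecc e v0.
Proof.
move=> min_v0; apply/eqP; rewrite eqn_leq; apply/andP; split; rewrite /radius.
  have: v0 \in index_enum T by rewrite mem_index_enum.
  elim: (index_enum T) => // x s IHs; rewrite inE big_cons.
  case/predU1P => [<-|/IHs le_s]; first exact: geq_minl.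
  exact: leq_trans (geq_minr _ _) le_s.
apply: (big_ind (fun x => ecc e v0 <= x)) => // [|x y lex ley];
  last by rewrite leq_min lex.
(* The neutral element [#|T|] of the minimum bounds every distance, as [find] never exceeds the
   length of its list. *)
apply/bigmax_leqP => u _; rewrite /dist.
by apply: leq_trans (find_size _ _) _; rewrite size_iota.
Qed.

(** * Hamming distance *)

Definition mismatch (u w : seq bool) : nat :=
  count (fun p : bool * bool => p.1 != p.2) (zip u w).

Section Hamming.
Variable n : nat.
Implicit Types u v w : n.-tuple bool.

Definition hamming u v := #|[set i | tnth u i != tnth v i]|.

Lemma hamming_eq0 u v : (hamming u v == 0) = (u == v).
Proof.
rewrite cards_eq0; apply/eqP/eqP => [uv|->]; last first.
  by apply/setP => i; rewrite !inE eqxx.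
apply: eq_from_tnth => i; apply/eqP.
by have := in_set0 i; rewrite -uv inE => /negbFE.
Qed.

Lemma hamming_sym u v : hamming u v = hamming v u.
Proof. by apply: eq_card => i; rewrite !inE eq_sym. Qed.

Lemma hamming_triangle u v w : hamming u w <= hamming u v + hamming v w.
Proof.
apply: leq_trans (leq_card_setU _ _); apply: subset_leq_card.
apply/subsetP => i; rewrite !inE.
by case: (eqVneq (tnth u i) (tnth v i)) => [->|].
Qed.

Lemma hamming_mismatch u v : hamming u v = mismatch u v.
Proof.
rewrite /mismatch.
have -> : hamming u v = \sum_(i < n) (nth false u i != nth false v i).
  rewrite /hamming -sum1_card big_mkcond /=; apply: eq_bigr => i _.
  by rewrite inE !(tnth_nth false).
case: u v => [u /= /eqP su] [v /= /eqP sv].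
elim: u v n su sv => [|a u IHu] [|b v] m /= <- //; first by rewrite big_ord0.
by case=> sv; rewrite big_ord_recl /= -(IHu _ _ erefl sv).
Qed.

End Hamming.

Lemma run_free_sub (r n : nat) (u w : n.-tuple bool) :
  (forall i, tnth w i -> tnth u i) -> run_free r u -> run_free r w.
Proof.
move=> sub_wu; apply: contraLR => /run_freeP[a]; rewrite size_tuple => lta onea.
apply/run_freeP; exists a; first by rewrite size_tuple.
move=> j lejr; have ltaj : a + j < n.
  by apply: leq_ltn_trans lta; rewrite leq_add2l.
have := onea j lejr; have nthE (t : n.-tuple bool) :
  nth false t (a + j) = tnth t (Ordinal ltaj) by rewrite (tnth_nth false).
by rewrite !nthE => /sub_wu.
Qed.

(** * Graph distance equals Hamming distance *)

Section OGammaDistance.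
Variables r n : nat.
Implicit Types u v : OGamma r n.

Lemma hamming_leq_path u p :
  path (@OGamma_adj r n) u p -> hamming (val u) (val (last u p)) <= size p.
Proof.
elim: p u => [|w p IHp] u /=; first by rewrite leqn0 hamming_eq0.
case/andP => /eqP uw /IHp le_p.
apply: leq_trans (hamming_triangle _ (val w) _) _.
by rewrite -add1n leq_add // /hamming uw.
Qed.

(* A shortest path first deletes the superfluous ones and then adds the
   missing ones, so that each vertex on it lies below [u] or below [v]. *)
Lemma hamming_step u v (d : nat) : hamming (val u) (val v) = d.+1 ->
  exists2 w : OGamma r n, OGamma_adj u w & hamming (val w) (val v) = d.
Proof.
move=> uv_d.
have [i uvi below] : exists2 i, tnth (val u) i != tnth (val v) i &
    tnth (val v) i -> forall j, tnth (val u) j -> tnth (val v) j.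
  have [/existsP[i /andP[ui vi]]|/existsPn noi] :=
    boolP [exists i, tnth (val u) i && ~~ tnth (val v) i].
    by exists i; rewrite ?ui (negbTE vi).
  have [|[i]] := set_0Vmem [set i | tnth (val u) i != tnth (val v) i].
    by move/eqP; rewrite -cards_eq0 -/(hamming _ _) uv_d.
  rewrite inE; exists i => // _ j uj.
  by have := noi j; rewrite uj negbK.
pose w := [tuple tnth (val (if j == i then v else u)) j | j < n].
have wE j : tnth w j = tnth (val (if j == i then v else u)) j.
  by rewrite tnth_mktuple.
have wP : run_free r w.
  case vi : (tnth (val v) i).
    apply: run_free_sub (valP v) => j; rewrite wE; case: eqP => // _.
    exact: below.
  apply: run_free_sub (valP u) => j; rewrite wE; case: eqP => // ->.
  by rewrite vi.
exists (Sub w wP : OGamma r n).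
  rewrite /OGamma_adj /= -(cards1 i); apply/eqP/eq_card => j; rewrite !inE wE.
  by case: (eqVneq j i) => [->|_]; rewrite ?uvi ?eqxx.
apply/eqP; rewrite -eqSS -uv_d /hamming.
rewrite (cardsD1 i [set j | tnth (val u) j != _]).
rewrite inE uvi eqSS; apply/eqP/eq_card => j; rewrite !inE /= wE.
by case: (eqVneq j i) => [->|_] /=; rewrite ?eqxx.
Qed.

Lemma dist_OGamma u v : dist (@OGamma_adj r n) u v = hamming (val u) (val v).
Proof.
apply: dist_eq => [p /hamming_leq_path + <-|] //.
have [d uv_d] : exists d, hamming (val u) (val v) = d by eexists.
rewrite uv_d; elim: d u uv_d => [|d IHd] u uv_d.
  move/eqP: uv_d; rewrite hamming_eq0 => /eqP/val_inj uv.
  by exists [::].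
have [w uw /IHd[p [pathp lastp sizep]]] := hamming_step uv_d.
by exists (w :: p); rewrite /= uw pathp lastp sizep.
Qed.

End OGammaDistance.

(* Greedy number of disjoint factors [0^(r+1)] of [0^s w], for [s <= r]. *)
Fixpoint blocks (r s : nat) (w : seq bool) : nat :=
  match w with
  | [::] => 0
  | true :: w' => blocks r 0 w'
  | false :: w' => if s == r then (blocks r 0 w').+1 else blocks r s.+1 w'
  end.

(* A farthest word from [w]: its complement, except that the last zero of each
   block counted by [blocks] is kept. *)
Fixpoint antipode (r s : nat) (w : seq bool) : seq bool :=
  match w with
  | [::] => [::]
  | true :: w' => false :: antipode r 0 w'
  | false :: w' =>
    if s == r then false :: antipode r 0 w' else true :: antipode r s.+1 w'
  end.

(** * Greedy blocks and extremal agreement *)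

Section Blocks.
Variable r : nat.
Implicit Types (s n : nat) (u w : seq bool).

(** When the counter that is ahead completes a block, it restarts at 0 with one block gained and is
    then the one behind; so the lead never exceeds one. *)
Lemma blocks_mono s s' w : s <= s' <= r ->
  blocks r s w <= blocks r s' w <= (blocks r s w).+1.
Proof.
elim: w s s' => [|[] w IHw] s s' //= /andP[les les'].
  by rewrite leqnn leqnSn.
have [s'r|s'r] := eqVneq s' r; have [sr|sr] := eqVneq s r.
- by rewrite leqnn leqnSn.
- have /andP[] := IHw 0 s.+1 ltac:(lia).
  by rewrite ltnS => -> ->.
- by lia.
- by apply: IHw; lia.
Qed.

(** The [r.+1] zeros of each counted block and the ones of [w] are distinct letters of [0^s w]. *)
Lemma blocks_count s w : s <= r ->
  blocks r s w * r.+1 + count id w <= s + size w.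
Proof.
elim: w s => [|[] w IHw] s les //=; first by have := IHw 0 isT; lia.
case: eqP => [->|sr]; first by have := IHw 0 isT; lia.
by have := IHw s.+1 ltac:(lia); lia.
Qed.

Lemma blocks_leq_div w : blocks r 0 w <= size w %/ r.+1.
Proof. by rewrite leq_divRL //; have := blocks_count w (leq0n r); lia. Qed.

Lemma count_blocks_eq w :
  blocks r 0 w = size w %/ r.+1 -> count id w <= size w %% r.+1.
Proof.
move=> wE; have := blocks_count w (leq0n r).
by rewrite wE {2}(divn_eq (size w) r.+1) add0n leq_add2l.
Qed.

(** At most [size w %% r.+1] ones remain, too few for a forbidden run; so extremal words are
    automatically vertices. *)
Lemma run_free_blocks w : blocks r 0 w = size w %/ r.+1 -> run_free r w.
Proof.
move/count_blocks_eq => lew; apply/negP => /infixW/(leq_count_subseq id).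
by move/leq_trans/(_ lew); rewrite count_nseq mul1n leqNgt ltn_pmod.
Qed.

Lemma blocks_nseq s n : s <= r -> blocks r s (nseq n false) = (s + n) %/ r.+1.
Proof.
elim: n s => [|n IHn] s les /=; first by rewrite addn0 divn_small.
case: eqP => [->|sr]; last by rewrite IHn ?addSnnS //; lia.
by rewrite IHn // add0n -addSnnS divnDl ?dvdnn // divnn.
Qed.

Lemma blocks_block s w : s <= r ->
  blocks r s (nseq (r.+1 - s) false ++ w) = (blocks r 0 w).+1.
Proof.
move=> les; have [d] := ubnP (r - s); elim: d s les => // d IHd s les ltd.
rewrite subSn //=; case: eqP => [->|sr]; first by rewrite subnn.
by rewrite -subSS IHd; lia.
Qed.

Lemma blocks_zeros w : blocks r 0 (nseq r.+1 false ++ w) = (blocks r 0 w).+1.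
Proof. by rewrite -(@blocks_block 0) // subn0. Qed.

Lemma blocks_cat1 s u w :
  blocks r s (u ++ true :: w) = blocks r s u + blocks r 0 w.
Proof. by elim: u s => [|[] u IHu] s //=; case: eqP; rewrite IHu. Qed.

(** Only a one resets the counter before the first counted block, so that block either extends the
    [s] pending zeros or directly follows a one. These are the insertion places allowed in [vee]. *)
Lemma blocks_gt0 s w : s <= r -> 0 < blocks r s w ->
  (exists w', w = nseq (r.+1 - s) false ++ w') \/
  (exists u w', w = u ++ true :: nseq r.+1 false ++ w').
Proof.
elim: w s => [|[] w IHw] s les //=.
  move=> /IHw[] // => [[w' ->]|[u [w' ->]]]; right.
    by exists [::], w'; rewrite subn0.
  by exists (true :: u), w'.
case: eqP => [-> _|sr]; first by left; exists w; rewrite subSnn.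
move=> /IHw[] // => [|[w' ->]|[u [w' ->]]]; first lia.
  by left; exists w'; rewrite (subSn les) subSS.
by right; exists (false :: u), w'.
Qed.

Lemma nseq_cat_cons (T : Type) n (x : T) (t : seq T) :
  nseq n x ++ x :: t = nseq n.+1 x ++ t.
Proof. by elim: n => //= n ->. Qed.

Lemma run_free_nseq_false s w : s <= r ->
  run_free r (nseq s true ++ false :: w) = run_free r w.
Proof.
rewrite /run_free => les; congr (~~ _).
have not_prefix n : n <= r ->
  prefix (nseq r.+1 true) (nseq n true ++ false :: w) = false.
  by elim: n (r) => [|n IHn] [|m] //=; rewrite ltnS => /IHn.
elim: s les => [|s IHs] les; first by rewrite infix_consl (not_prefix 0).
by rewrite cat_cons infix_consl IHs 1?ltnW // (not_prefix s.+1).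
Qed.

Lemma run_free_nseq_true s : s <= r -> run_free r (nseq s true).
Proof.
move=> les; apply/negP => /infixW/(leq_count_subseq id).
by rewrite !count_nseq !mul1n; lia.
Qed.

Lemma run_free_catr u w : run_free r (u ++ w) -> run_free r w.
Proof. exact/contra/infix_catl. Qed.

(** The prefix [1^s] records that [u] disagreed with all [s] pending zeros of [w]; disagreeing up to
    the end of the block would create [1^(r+1)]. An earlier agreement resets the counter, and it
    pays for the at most one block lost by [blocks_mono]. *)
Lemma mismatch_blocks s u w : s <= r -> size u = size w ->
  run_free r (nseq s true ++ u) -> mismatch u w + blocks r s w <= size w.
Proof.
rewrite /mismatch; elim: w u s => [|c w IHw] [|b u] s //= les [su] freeu.
have freeu0 : run_free r (nseq 0 true ++ u).
  by move: freeu; rewrite -cat_rcons => /run_free_catr.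
have := IHw u 0 isT su freeu0.
case: c => /=; first by case: b {freeu} => /=; lia.
case: (eqVneq s r) => [sr|sr].
  case: b freeu => /=; last by lia.
  by rewrite nseq_cat_cons sr /run_free prefix_infix.
have lts : s.+1 <= r by lia.
have := @blocks_mono 0 s.+1 w lts.
case: b freeu => /=; last by lia.
rewrite nseq_cat_cons => /(IHw u s.+1 lts su); lia.
Qed.

Lemma size_antipode s w : size (antipode r s w) = size w.
Proof.
by elim: w s => [|[] w IHw] s //=; last case: ifP => _ /=; rewrite IHw.
Qed.

(** Here [1^s] is the run of ones already written; the zero written when a block completes cuts it
    at length [r]. *)
Lemma run_free_antipode s w : s <= r ->
  run_free r (nseq s true ++ antipode r s w).
Proof.
elim: w s => [|[] w IHw] s les /=.
- by rewrite cats0 run_free_nseq_true.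
- by rewrite run_free_nseq_false // (IHw 0).
- case: eqP => [sr|sr]; first by rewrite run_free_nseq_false // (IHw 0).
  by rewrite nseq_cat_cons IHw //; lia.
Qed.

Lemma mismatch_antipode s w :
  mismatch (antipode r s w) w + blocks r s w = size w.
Proof.
rewrite /mismatch; elim: w s => [|[] w IHw] s //=; first by have := IHw 0; lia.
by case: eqP => _ /=; [have := IHw 0 | have := IHw s.+1]; lia.
Qed.

End Blocks.

(** * Eccentricity, radius and center *)

Lemma zero_word_run_free (r n : nat) : run_free r (zero_word n).
Proof. by apply/negP => /infixW/(leq_count_subseq id); rewrite !count_nseq. Qed.

Section Center.
Variables r n : nat.
Implicit Types v : OGamma r n.

Lemma ecc_OGamma v : ecc (@OGamma_adj r n) v = n - blocks r 0 (val v).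
Proof.
apply/eqP; rewrite eqn_leq; apply/andP; split.
  apply/bigmax_leqP => u _; rewrite dist_OGamma hamming_sym hamming_mismatch.
  have := @mismatch_blocks r 0 (val u) (val v) isT.
  rewrite !size_tuple => /(_ erefl (valP u)) bound.
  rewrite -(leq_add2r (blocks r 0 (val v))) subnK //.
  exact: leq_trans (leq_addl _ _) bound.
have sa : size (antipode r 0 (val v)) == n by rewrite size_antipode size_tuple.
have freea : run_free r (Tuple sa) by exact: (@run_free_antipode r 0).
rewrite -[n in n - _](size_tuple (val v)).
rewrite -(mismatch_antipode r 0 (val v)) addnK.
apply: leq_trans (leq_bigmax (Sub (Tuple sa) freea : OGamma r n)).
by rewrite dist_OGamma hamming_sym hamming_mismatch.
Qed.

Lemma ecc_zero_word v : val v = zero_word n ->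
  ecc (@OGamma_adj r n) v = n - n %/ r.+1.
Proof. by move=> v0; rewrite ecc_OGamma v0 /= blocks_nseq. Qed.

Lemma blocks_OGamma v : blocks r 0 (val v) <= n %/ r.+1.
Proof. by have := blocks_leq_div r (val v); rewrite size_tuple. Qed.

Lemma rad_OGammaE : rad_OGamma r n = n - n %/ r.+1.
Proof.
pose z : OGamma r n := Sub (zero_word n) (zero_word_run_free r n).
rewrite -(ecc_zero_word (erefl : val z = _)) /rad_OGamma.
apply: radius_eq => v; rewrite ecc_zero_word // ecc_OGamma.
exact/leq_sub2l/blocks_OGamma.
Qed.

Lemma mem_Z (w : n.-tuple bool) : (w \in Z r n) = (blocks r 0 w == n %/ r.+1).
Proof.
have center_blocks v : (v \in center (@OGamma_adj r n)) =
    (blocks r 0 (val v) == n %/ r.+1).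
  rewrite inE -/(rad_OGamma r n) rad_OGammaE ecc_OGamma.
  move: (blocks_OGamma v) (leq_div n r.+1); move: (blocks r 0 _) => b; lia.
apply/imsetP/idP => [[v vZ ->]|w_max]; first by rewrite -center_blocks.
have freew : run_free r w.
  by apply: run_free_blocks; rewrite size_tuple (eqP w_max).
by exists (Sub w freew : OGamma r n); rewrite ?center_blocks.
Qed.

End Center.

(** * Recursion for the center *)

Lemma Z_vee (r m : nat) : Z r (m + r.+1) = vee r (Z r m).
Proof.
apply/setP => w; rewrite mem_Z divnDr // divnn addn1 inE.
have drop_block p t :
    w = p ++ nseq r.+1 false ++ t :> seq bool -> size (p ++ t) == m.
  move/(congr1 size); rewrite size_tuple !size_cat size_nseq addnCA addnC.
  by move/addnI ->.
apply/eqP/existsP => [w_max|[h /andP[]]].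
  have [||[t wE]|[p [t wE]]] := @blocks_gt0 r 0 w; rewrite ?w_max //.
    rewrite subn0 in wE; have st := @drop_block [::] t wE.
    exists (Tuple st); rewrite mem_Z wE eqxx andbT; apply/eqP/succn_inj.
    by rewrite -w_max wE blocks_zeros.
  have st : size (rcons p true ++ t) == m.
    by apply: drop_block; rewrite cat_rcons.
  exists (Tuple st); rewrite mem_Z /=; apply/andP; split.
    apply/eqP/succn_inj; rewrite -w_max wE cat_rcons !blocks_cat1.
    by rewrite blocks_zeros // addnS.
  apply/orP; right; apply/existsP.
  (* The one just before the block has 0-based index [size p], so [take i.+1] returns
     [rcons p true]. *)
  have ltpm : size p < m by rewrite -(eqP st) size_cat size_rcons ltn_addr.
  exists (Ordinal ltpm); rewrite (tnth_nth false) /= nth_cat size_rcons leqnn.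
  rewrite nth_rcons ltnn eqxx /= take_size_cat ?size_rcons //.
  by rewrite drop_size_cat ?size_rcons // cat_rcons wE.
rewrite mem_Z => /eqP h_max /orP[/eqP ->|/existsP[i /andP[hi /eqP ->]]].
  by rewrite blocks_zeros ?h_max.
have lti : i < size h by rewrite size_tuple.
rewrite (tnth_nth false) in hi.
rewrite -h_max -[in RHS](cat_take_drop i.+1 h) (take_nth false) //.
by rewrite hi !cat_rcons !blocks_cat1 blocks_zeros addnS.
Qed.

(** * Cardinality of the center *)

Section Counting.
Variable r : nat.
Implicit Types s n q k j t x : nat.

Lemma card_tuple_bool_rec n (P : pred (seq bool)) :
  #|[set w : n.+1.-tuple bool | P w]| =
  #|[set w : n.-tuple bool | P (true :: w)]| +
  #|[set w : n.-tuple bool | P (false :: w)]|.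
Proof.
pose c b (w : n.-tuple bool) := [tuple of b :: w].
have inj_c b : injective (c b).
  by move=> u w /(congr1 val) /= [uw]; apply: val_inj.
rewrite -(card_imset _ (inj_c true)) -(card_imset _ (inj_c false)).
rewrite -cardsUI (_ : _ :&: _ = set0) ?cards0 ?addn0; last first.
  apply/setP => w; rewrite !inE; apply/negP => /andP[/imsetP[u _ ->]].
  by case/imsetP => u' _ /(congr1 val).
apply: eq_card => w; rewrite !inE.
apply/idP/orP => [|[]/imsetP[u + ->]]; rewrite ?inE //.
case/tupleP: w => -[] u Pu; [left | right]; apply/imsetP;
  by exists u; rewrite ?inE.
Qed.

Definition words s n q := #|[set w : n.-tuple bool | blocks r s w == q]|.

Lemma words_eq0 n q : n < q * r.+1 -> words 0 n q = 0.
Proof.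
move=> ltn; apply/eqP; rewrite cards_eq0; apply/eqP/setP => w; rewrite !inE.
apply/eqP => wq; have := blocks_leq_div r w.
by rewrite wq size_tuple leq_divRL // leqNgt ltn.
Qed.

Lemma words_rec s n q :
  words s n.+1 q = words 0 n q +
    (if s == r then if q is q'.+1 then words 0 n q' else 0
     else words s.+1 n q).
Proof.
rewrite /words (card_tuple_bool_rec n (fun w => blocks r s w == q)) /=.
congr (_ + _); case: ifP => // _; case: q => //.
by apply/eqP; rewrite cards_eq0; apply/eqP/setP => w; rewrite !inE.
Qed.

(* Deleting [x - 1] zero blocks from a word leaves any word [h] of length [k],
   and if [h] has [t] ones then the blocks were spread over [t + 1] slots. *)
Definition nb_center k x := \sum_(t < k.+1) 'C(k, t) * 'C((x + t).-1, t).

(** The forward difference of [nb_center j] at [q], put in this form by Pascal's rule. *)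
Definition nb_center_diff j q := \sum_(t < j.+1) 'C(j, t.+1) * 'C(q + t, t).

(** The truncated predecessor turns the terms with [t > 0] into [C(t - 1, t) = 0]; this boundary
    value starts the recursion in [wordsE]. *)
Lemma nb_center0 k : nb_center k 0 = 1.
Proof.
rewrite /nb_center big_ord_recl !bin0 big1 // => t _.
by rewrite /= /bump /= add0n (@bin_small t) ?muln0.
Qed.

Lemma nb_center_diff0 q : nb_center_diff 0 q = 0.
Proof. by rewrite /nb_center_diff big_ord1. Qed.

Lemma nb_centerS k q : nb_center k q.+1 = nb_center k q + nb_center_diff k q.
Proof.
rewrite /nb_center !big_ord_recl !bin0 -addnA; congr (_ + _).
rewrite /nb_center_diff big_ord_recr /= bin_small // mul0n addn0 -big_split /=.
by apply: eq_bigr => t _; rewrite /bump /= add1n addnS /= binS mulnDr.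
Qed.

Lemma nb_center_diffS j q :
  nb_center_diff j.+1 q = nb_center_diff j q + nb_center j q.+1.
Proof.
rewrite /nb_center_diff big_ord_recr /= bin_small // mul0n addn0 -big_split /=.
by apply: eq_bigr => t _; rewrite binS mulnDl.
Qed.

(** The slack [k] counts the letters of [0^s w] outside the [q] blocks. A leading one wastes itself
    and the [s] pending zeros, leaving slack [k - s - 1]; a leading zero keeps [k]. The
    contributions of leading ones add up to [nb_center_diff (k - s) q] by [nb_center_diffS]. *)
Lemma wordsE s n q k : s <= r -> k <= r -> s + n = k + q * r.+1 ->
  words s n q = nb_center k q + nb_center_diff (k - s) q.
Proof.
elim: n s q k => [|n IHn] s q k les lek sn.
  have [-> ->] : q = 0 /\ k = s by case: q sn => [|q]; rewrite ?mulSn; lia.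
  rewrite subnn nb_center0 nb_center_diff0 addn0.
  apply/eqP/cards1P; exists [tuple]; apply/setP => w.
  by rewrite !inE tuple0 eqxx.
rewrite words_rec.
(* If [k <= s], fewer than [q * r.+1] letters remain after a leading one. *)
have -> : words 0 n q = if s < k then nb_center (k - s.+1) q.+1 else 0.
  case: ifP => ltsk; last by rewrite words_eq0 //; lia.
  by rewrite nb_centerS (IHn 0 q (k - s.+1)) ?subn0 //; lia.
case: (eqVneq s r) => [sr|sr].
  rewrite ltnNge sr lek /= (eqP (lek : k - r == 0)) nb_center_diff0 addn0 add0n.
  case: q sn => [|q] sn; first lia.
  by rewrite (IHn 0 q k) ?subn0 ?nb_centerS //; lia.
rewrite (IHn s.+1 q k) //; try lia.
case: ifP => ltsk; last first.
  by rewrite (_ : k - s.+1 = 0) 1?(_ : k - s = 0) //; lia.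
by rewrite -(subnSK ltsk) nb_center_diffS; lia.
Qed.

Lemma card_Z k q : k <= r -> #|Z r (k + q * r.+1)| = nb_center k q.+1.
Proof.
move=> lek; rewrite nb_centerS -[in nb_center_diff k](subn0 k).
rewrite -(@wordsE 0 (k + q * r.+1)) //; apply: eq_card => w.
by rewrite mem_Z inE divnDMl // divn_small.
Qed.

End Counting.

Local Open Scope ring_scope.

(** * Polynomiality and the Vandermonde system *)

(** The product over [t!] is the rising factorial form of [C(x + t - 1, t)] as a polynomial in
    [x]. *)
Definition nb_center_poly (k : nat) : {poly rat} :=
  \sum_(t < k.+1) ('C(k, t)%:R / t`!%:R) *: \prod_(i < t) ('X + i%:R%:P).

Lemma size_nb_center_poly (k : nat) : (size (nb_center_poly k) <= k.+1)%N.
Proof.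
apply: leq_trans (size_sum _ _ _) _; apply/bigmax_leqP => t _.
apply: leq_trans (size_scale_leq _ _) _.
have -> : \prod_(i < t) ('X + i%:R%:P) =
    \prod_(i < t) ('X - (- i%:R)%:P) :> {poly rat}.
  by apply: eq_bigr => i _; rewrite polyCN opprK.
by rewrite size_prod_XsubC /index_enum -enumT size_enum_ord ltn_ord.
Qed.

Lemma prod_rising_bin (x t : nat) :
  \prod_(i < t) (x.+1%:R + i%:R) = ('C(x + t, t) * t`!)%:R :> rat.
Proof.
elim: t => [|t IHt]; first by rewrite big_ord0 bin0.
rewrite big_ord_recr /= IHt -natrD -natrM; congr (_%:R).
rewrite factS mulnA [('C(_, _.+1) * _)%N]mulnC addnS.
by rewrite -mul_bin_diag /= addSn; lia.
Qed.

Lemma horner_nb_center_poly (k x : nat) :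
  (nb_center_poly k).[x.+1%:R] = (nb_center k x.+1)%:R.
Proof.
rewrite /nb_center_poly horner_sum /nb_center natr_sum; apply: eq_bigr => t _.
rewrite hornerZ horner_prod natrM -mulrA; congr (_ * _).
under eq_bigr do rewrite hornerD hornerX hornerC.
rewrite prod_rising_bin natrM mulrCA mulVf ?mulr1 //.
by rewrite pnatr_eq0 -lt0n fact_gt0.
Qed.

(** The entries of [card_col] are values of [nb_center_poly k] at [1, ..., k + 1], hence [pow_mx k]
    times its coefficients in decreasing degree; inverting the matrix recovers them. *)
Lemma coef_col_nb_center (r k : nat) (j : 'I_k.+1) : (k <= r)%N ->
  coef_col r k j 0 = (nb_center_poly k)`_(k - j).
Proof.
move=> lek; pose c : 'cV[rat]_k.+1 := \col_j (nb_center_poly k)`_(k - j).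
suff cE : card_col r k = pow_mx k *m c.
  by rewrite /coef_col cE mulKmx ?pow_mx_unit // mxE.
apply/colP => i; rewrite !mxE card_Z // -horner_nb_center_poly.
rewrite (horner_coef_wide _ (size_nb_center_poly k)) (reindex_inj rev_ord_inj).
by apply: eq_bigr => l _; rewrite !mxE /= subSS mulrC.
Qed.

Lemma ceil_natr_div (a b c : nat) :
  (a <= c * b.+1)%N -> (c * b.+1 < a + b.+1)%N ->
  Num.ceil (a%:R / b.+1%:R : rat) = c%:Z.
Proof.
move=> le_a lt_a; apply: ceil_def.
rewrite ltr_pdivlMr ?ler_pdivrMr ?ltr0Sn // intrB mulrBl mul1r ltrBlDr.
by rewrite -!natrM -natrD ltr_nat ler_nat le_a lt_a.
Qed.

Theorem theorem4p1 (r n : nat) (hr : (1 <= r)%N) (hn : (1 <= n)%N) :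
  [/\ zero_word n \in Z r n,
      (rad_OGamma r n)%:Z = Num.ceil ((n * r)%:R / r.+1%:R : rat),
      (n = 0 %[mod r.+1])%N ->
        Z r n = [set zero_word n] /\ #|Z r n| = 1%N
    & forall k : nat, (n %% r.+1)%N = k -> k <> 0%N ->
        [/\ Z r k = [set: k.-tuple bool],
            forall m : nat, n = (m + r.+1)%N ->
              Z r (m + r.+1)%N = vee r (Z r m)
          & #|Z r n|%:R =
              \sum_(j < k.+1)
                coef_col r k j 0
                * (Num.ceil (n%:R / r.+1%:R : rat))%:~R ^+ (k - j)%N]].
Proof.
have zeroZ : zero_word n \in Z r n by rewrite mem_Z blocks_nseq.
have nE := divn_eq n r.+1; have ltr := ltn_pmod n (ltn0Sn r).
split=> // [|n0|k nk k0].
(* With [n = q(r+1) + k], one has [(n - q)(r+1) = nr + k] and [k <= r]. *)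
- rewrite rad_OGammaE; apply/esym/ceil_natr_div; move: nE ltr;
    move: (n %/ r.+1)%N (n %% r.+1)%N => q k; rewrite !mulnBl !mulnS; nia.
- suff -> : Z r n = [set zero_word n] by rewrite cards1.
  apply/setP => w; rewrite inE; apply/idP/eqP => [|->] //.
  rewrite mem_Z -[n in (n %/ _)%N](size_tuple w) => /eqP/count_blocks_eq.
  rewrite size_tuple n0 mod0n leqn0 => /eqP count0.
  apply: eq_from_tnth => i; rewrite !(tnth_nth false) nth_nseq if_same.
  apply/negbTE/negP => wi; move/eqP: count0; rewrite -leqn0 leqNgt -has_count.
  by case/hasP; exists (nth false w i); rewrite ?mem_nth ?size_tuple.
have lek : (k <= r)%N by rewrite -nk -ltnS.
split=> [|m _|].
- apply/setP => w; have := blocks_leq_div r w.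
  by rewrite mem_Z inE size_tuple divn_small // leqn0.
- exact: Z_vee.
(* Since [k] is nonzero the ceiling is [q + 1], the point at which [card_Z] evaluates the
   polynomial. *)
have -> : Num.ceil (n%:R / r.+1%:R : rat) = ((n %/ r.+1).+1)%:Z.
  apply: ceil_natr_div; rewrite mulSn; move: nE ltr nk;
    move: (n %/ r.+1)%N (n %% r.+1)%N => q l; lia.
rewrite [in LHS]nE nk addnC card_Z // -horner_nb_center_poly.
rewrite (horner_coef_wide _ (size_nb_center_poly k)) (reindex_inj rev_ord_inj).
by apply: eq_bigr => j _; rewrite coef_col_nb_center //= subSS.
Qed.
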